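(* Let $q$ be a prime power and $d\ge 2$ an integer. Let $\Gamma^\ast$ be a divisible design graph on vertex set $V^\ast$ with parameters $$v^\ast = \frac{q^d (q^d - 1)}{q-1},\quad k^\ast = q^{d-1}(q^d - 1),\quad \lambda_1^\ast = q^{d-1}(q^d - q^{d-1} - 1),\quad \lambda_2^\ast = q^{d-2}(q-1)(q^d - 1),$$ whose canonical partition consists of $m^\ast=(q^d-1)/(q-1)$ classes $\mathcal{P}_1,\dots,\mathcal{P}_{m^\ast}$, each of size $n^\ast = q^d$. Let $\mathcal{D}^\ast=(\mathcal{P}^\ast,\mathcal{B}^\ast)$ be a symmetric $2$-$\left(\frac{q^d-1}{q-1},\, q^{d-1},\, q^{d-2}(q-1)\right)$ design, with point set $\mathcal{P}^\ast$ disjoint from $V^\ast$, and let $\phi$ be an arbitrary bijection from the set $\{\mathcal{P}_1,\dots,\mathcal{P}_{m^\ast}\}$ of canonical classes of $\Gamma^\ast$ to the block set $\mathcal{B}^\ast$. Define the graph $\Gamma$ with vertex set $V=V^\ast\cup\mathcal{P}^\ast$ as follows: two distinct vertices of $V^\ast$ are adjacent in $\Gamma$ if and only if they are adjacent in $\Gamma^\ast$; no two vertices of $\mathcal{P}^\ast$ are adjacent (so $\mathcal{P}^\ast$ is a coclique); and a vertex $x\in\mathcal{P}_i\subseteq V^\ast$ ($i\in\{1,\dots,m^\ast\}$) is adjacent to a vertex $y\in\mathcal{P}^\ast$ if and only if $y$ belongs to the block $\phi(\mathcal{P}_i)$. Then $\Gamma$ is a strongly regular graph with parameters $$\left(\frac{q^{2d}-1}{q-1},\;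 q^{2d-1},\; q^{2d-2}(q-1),\; q^{2d-2}(q-1)\right).$$
   Context: A $k$-regular graph on $v$ vertices is a divisible design graph with parameters $(v,k,\lambda_1,\lambda_2,m,n)$ if its vertex set can be partitioned into $m$ classes of size $n$ such that any two distinct vertices in the same class have exactly $\lambda_1$ common neighbours, and any two vertices in different classes have exactly $\lambda_2$ common neighbours (the graph being neither complete nor edgeless). Such a partition into classes is called a canonical partition. A symmetric $2$-$(v,k,\lambda)$ design is an incidence structure with $v$ points and $v$ blocks, each block containing $k$ points, and every pair of distinct points contained in exactly $\lambda$ blocks. A strongly regular graph with parameters $(v,k,\lambda,\mu)$ is a $k$-regular graph on $v$ vertices in which any two adjacent vertices have exactly $\lambda$ common neighbours and any two distinct non-adjacent vertices have exactly $\mu$ common neighbours. *)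

(* Defs.v *)
From mathcomp Require Import all_boot.

Set Implicit Arguments.
Unset Strict Implicit.
Unset Printing Implicit Defensive.

Definition prime_power (q : nat) : Prop :=
  exists p r : nat, [/\ prime p, 0 < r & q = p ^ r].

(** A graph on the finite vertex type [T] is given by its adjacency relation. *)
Definition simple_graph (T : finType) (e : rel T) : Prop :=
  symmetric e /\ irreflexive e.

Definition neighbours (T : finType) (e : rel T) (x : T) : {set T} :=
  [set y | e x y].

Definition common_neighbours (T : finType) (e : rel T) (x y : T) : {set T} :=
  neighbours e x :&: neighbours e y.

Definition regular_graph (T : finType) (e : rel T) (v k : nat) : Prop :=
  [/\ simple_graph e, #|T| = v & forall x, #|neighbours e x| = k].

Definition complete (T : finType) (e : rel T) : Prop :=
  forall x y, x != y -> e x y.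

Definition edgeless (T : finType) (e : rel T) : Prop :=
  forall x y, ~~ e x y.

Definition canonical_partition (T : finType) (e : rel T)
    (l1 l2 m n : nat) (P : {set {set T}}) : Prop :=
  [/\ partition P [set: T],
      #|P| = m,
      forall C, C \in P -> #|C| = n,
      forall C x y, C \in P -> x \in C -> y \in C -> x != y ->
        #|common_neighbours e x y| = l1 &
      forall C D x y, C \in P -> D \in P -> C != D -> x \in C -> y \in D ->
        #|common_neighbours e x y| = l2].

Definition divisible_design_graph (T : finType) (e : rel T)
    (v k l1 l2 m n : nat) : Prop :=
  [/\ regular_graph e v k, ~ complete e, ~ edgeless e &
      exists P, canonical_partition e l1 l2 m n P].

(** Following the convention without a non-degeneracy clause, complete and
    edgeless graphs are not excluded here. *)
Definition strongly_regular_graph (T : finType) (e : rel T)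
    (v k l mu : nat) : Prop :=
  [/\ regular_graph e v k,
      forall x y, e x y -> #|common_neighbours e x y| = l &
      forall x y, x != y -> ~~ e x y -> #|common_neighbours e x y| = mu].

(** [inc y b] means that the point [y] belongs to the block [b]. *)
Definition symmetric_design (Pt Bl : finType) (inc : Pt -> Bl -> bool)
    (v k l : nat) : Prop :=
  [/\ #|Pt| = v,
      #|Bl| = v,
      forall b, #|[set y | inc y b]| = k &
      forall y z, y != z -> #|[set b | inc y b && inc z b]| = l].

(** [classes P] is the type of the members of [P]. *)
Definition classes (T : finType) (P : {set {set T}}) : finType :=
  {C : {set T} | C \in P}.

Section Extension.

Variables (T Pt Bl : finType) (e : rel T) (P : {set {set T}}).
Variables (inc : Pt -> Bl -> bool) (phi : classes P -> Bl).

Definition class_point_adj (x : T) (y : Pt) : bool :=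
  [exists C : classes P, (x \in val C) && inc y (phi C)].

(** The disjoint union of the vertex set and the point set is the sum type. *)
Definition extension_adj : rel (T + Pt) := fun u w =>
  match u, w with
  | inl x, inl x' => e x x'
  | inl x, inr y => class_point_adj x y
  | inr y, inl x => class_point_adj x y
  | inr _, inr _ => false
  end.

End Extension.

(* Main.v *)
(** The delicate adjacency counts are those between a vertex and a class of the
    divisible design graph, and between two blocks of the design.  Both come
    from the same variance argument: if a family of integers has first moment
    [N c] and second moment [N c^2] over [N] indices, then it is constantly [c].
    Double counting the neighbours of a class [C] gives the moments of the
    numbers [|N(x) :&: C|] over all vertices [x]; the parameters satisfy
    [k^2 = l2 * v], which is exactly the equality case, so every vertex has
    [q^(d-1) (q-1)] neighbours in every class.  Likewise any two blocks meet in
    [l] points.  All the remaining counts are sums over the classes. *)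

Require Import Defs.
From mathcomp Require Import all_boot.
From mathcomp Require Import zify ring.

Set Implicit Arguments.
Unset Strict Implicit.
Unset Printing Implicit Defensive.

(** Summing [2 * (f i * c) <= f i ^ 2 + c ^ 2] over [A], the two moments make the sums equal, so
    equality holds termwise. This form of the variance avoids signed differences. *)
Lemma eq_const_of_moments (I : finType) (A : {set I}) (f : I -> nat) (c : nat) :
  \sum_(i in A) f i = #|A| * c -> \sum_(i in A) f i ^ 2 = #|A| * c ^ 2 ->
  {in A, forall i, f i = c}.
Proof.
move=> m1 m2.
have le i : i \in A -> 2 * (f i * c) <= f i ^ 2 + c ^ 2 ?= iff (f i == c).
  by move=> _; exact: nat_Cauchy.
have /leqifP := leqif_sum le.
rewrite -big_distrr -big_distrl big_split /= m1 m2 sum_nat_const.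
case: ifP => [/forall_inP fc _ i /fc/eqP // | _ lt].
by move: lt; rewrite (_ : 2 * _ = #|A| * c ^ 2 + #|A| * c ^ 2) ?ltnn //; ring.
Qed.

Lemma exchange_card (X Y : finType) (A : {set X}) (S : {set Y})
    (R : X -> Y -> bool) :
  \sum_(x in A) #|[set y in S | R x y]| = \sum_(y in S) #|[set x in A | R x y]|.
Proof.
under eq_bigr do rewrite -sum1dep_card big_mkcondr.
rewrite exchange_big /=; apply: eq_bigr => y _.
by rewrite -big_mkcondr sum1dep_card.
Qed.

Lemma sum_diag_offdiag (Y : finType) (S : {set Y}) (g : Y -> Y -> nat) (a b : nat) :
  {in S, forall y, g y y = a} ->
  {in S &, forall y z, y != z -> g y z = b} ->
  \sum_(y in S) \sum_(z in S) g y z = #|S| * (a + #|S|.-1 * b).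
Proof.
move=> ga gb; rewrite -sum_nat_const; apply: eq_bigr => y yS.
rewrite (bigD1 y) //= ga //; congr addn.
rewrite (eq_bigr (fun=> b)) => [|z /andP[zS zy]]; last by rewrite gb // eq_sym.
rewrite (eq_bigl (mem (S :\ y))) => [|z]; last by rewrite !inE andbC.
by rewrite sum_nat_const (cardsD1 y S) yS.
Qed.

(** The second moment counts triples [(x, y, z)] with [x] related to both [y] and [z]: pairs [y = z]
    contribute [a] each, the others [b]. *)
Lemma constant_incidence (X Y : finType) (A : {set X}) (S : {set Y})
    (R : X -> Y -> bool) (a b c : nat) :
  {in S, forall y, #|[set x in A | R x y]| = a} ->
  {in S &, forall y z, y != z -> #|[set x in A | R x y && R x z]| = b} ->
  #|S| * a = #|A| * c -> #|S| * (a + #|S|.-1 * b) = #|A| * c ^ 2 ->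
  {in A, forall x, #|[set y in S | R x y]| = c}.
Proof.
move=> Ra Rb m1 m2; apply: eq_const_of_moments.
  by rewrite exchange_card -m1 -sum_nat_const; apply: eq_bigr.
rewrite -m2 -(sum_diag_offdiag (g := fun y z => #|[set x in A | R x y && R x z]|)) //.
  under [RHS]eq_bigr => y _ do
    (under eq_bigr => z _ do rewrite -sum1dep_card big_mkcondr;
     rewrite exchange_big /=).
  rewrite exchange_big /=; apply: eq_bigr => x xA.
  rewrite expnS expn1 -sum1dep_card big_distrl /= big_mkcondr.
  apply: eq_bigr => y yS; case: (R x y); last by rewrite big1.
  by rewrite mul1n -big_mkcondr.
by move=> y yS; rewrite -[RHS](Ra y yS); apply: eq_card => x; rewrite !inE andbb.
Qed.

Section SymmetricDesign.

Variables (Pt Bl : finType) (inc : Pt -> Bl -> bool) (v k l : nat).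
Hypothesis design : symmetric_design inc v k l.
Hypotheses (k_gt1 : 1 < k) (params : l * v.-1 = k * k.-1).

(** With [r] blocks through [y], counting pairs of another point and a block joining it to [y] gives
    [l * v.-1 = r * k.-1]; [k_gt1] lets [k.-1] be cancelled. *)
Lemma symmetric_design_replication (y : Pt) : #|[set b | inc y b]| = k.
Proof.
case: design => cardP cardB blk pair.
have : \sum_(z in [set~ y]) #|[set b in [set b | inc y b] | inc z b]|
     = \sum_(b in [set b | inc y b]) #|[set z in [set~ y] | inc z b]|.
  exact: exchange_card.
rewrite (eq_bigr (fun=> l)) => [|z]; last first.
  by rewrite !inE eq_sym => /pair <-; apply: eq_card => b; rewrite !inE.
rewrite [X in _ = X](eq_bigr (fun=> k.-1)) => [|b]; last first.
  rewrite inE => yb; rewrite -(blk b) (cardsD1 y [set z | inc z b]) inE yb add1n /=.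
  by apply: eq_card => z; rewrite !inE.
rewrite !sum_nat_const cardsC1 cardP mulnC params => /eqP.
by rewrite eqn_pmul2r -?subn1 ?subn_gt0 // => /eqP.
Qed.

(** Each point of [b] lies on [k.-1] further blocks and each pair of them on [l.-1]; this fixes both
    moments of the intersection sizes of [b] with the other blocks. *)
Lemma symmetric_design_dual (b c : Bl) :
  b != c -> #|[set y | inc y b && inc y c]| = l.
Proof.
move=> bc; case: design => cardP cardB blk pair.
rewrite -(@constant_incidence _ _ [set~ b] [set y | inc y b]
    (fun d y => inc y d) k.-1 l.-1 l _ _ _ _ c).
- by apply: eq_card => y; rewrite !inE.
- move=> y; rewrite inE => yb.
  rewrite -(symmetric_design_replication y).
  rewrite (cardsD1 b [set d | inc y d]) inE yb add1n /=.
  by apply: eq_card => d; rewrite !inE.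
- move=> y z; rewrite !inE => yb zb /pair <-.
  rewrite (cardsD1 b [set d | inc y d && inc z d]) inE yb zb add1n /=.
  by apply: eq_card => d; rewrite !inE.
- by rewrite blk cardsC1 cardB mulnC mulnC -params mulnC.
(* Positivity keeps [l.-1] from truncating in [k.-1 + k.-1 * l.-1 = k.-1 * l]. *)
- have l_gt0 : 0 < l.
    by rewrite lt0n; apply/eqP => l0; move: params; rewrite l0; nia.
  rewrite blk cardsC1 cardB expnS expn1.
  rewrite (_ : k.-1 + _ = k.-1 * l); last by nia.
  by rewrite mulnA -params; ring.
- by rewrite !inE eq_sym.
Qed.

End SymmetricDesign.

Lemma card_set_sum (T U : finType) (p : pred (T + U)) :
  #|[set w | p w]| = #|[set x | p (inl x)]| + #|[set y | p (inr y)]|.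
Proof. by rewrite -!sum1dep_card big_sumType. Qed.

Lemma card_fibres (T U : finType) (A : {set T}) (f : T -> U) (Q : pred U) (c : nat) :
  (forall b, #|[set x in A | f x == b]| = c) ->
  #|[set x in A | Q (f x)]| = #|[set b | Q b]| * c.
Proof.
move=> fc; rewrite -sum_nat_const -sum1dep_card.
rewrite (partition_big f Q) => [|x /andP[]//].
apply: eq_big => [b|b Qb]; first by rewrite inE.
rewrite -(fc b) -sum1dep_card; apply: eq_bigl => x.
by rewrite -andbA; case: eqP => [->|]; rewrite ?Qb ?andbF.
Qed.

(* Transporting the class of a vertex along [phi] replaces the partition by a
   map to the blocks, whose fibres are the classes. *)
Lemma class_block_map (T Pt Bl : finType) (e : rel T) (l1 l2 m n : nat)
    (P : {set {set T}}) (inc : Pt -> Bl -> bool) (phi : classes P -> Bl) :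
  canonical_partition e l1 l2 m n P -> bijective phi ->
  exists beta : T -> Bl,
  [/\ forall x y, class_point_adj inc phi x y = inc y (beta x),
      forall b, #|[set x | beta x == b]| = n,
      forall x y, x != y -> beta x = beta y -> #|common_neighbours e x y| = l1 &
      forall x y, beta x != beta y -> #|common_neighbours e x y| = l2].
Proof.
move=> [partP _ cardC same diff] [psi phiK psiK].
have /and3P[/eqP covP trivP _] := partP.
have memP x : pblock P x \in P by rewrite pblock_mem // covP inE.
pose cl x : classes P := exist _ (pblock P x) (memP x).
have clE x (C : classes P) : (x \in val C) = (cl x == C).
  apply/idP/eqP => [xC | <-]; last by rewrite /= mem_pblock covP inE.
  by apply: val_inj; apply: def_pblock xC => //; exact: valP.
have mem_cl x : x \in val (cl x) by rewrite clE.
have phi_inj : injective phi by exact: can_inj phiK.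
exists (phi \o cl); split=> [x y|b|x y xy /phi_inj cxy|x y] /=.
- apply/existsP/idP => [[C]|]; last by exists (cl x); rewrite clE eqxx.
  by rewrite clE => /andP[/eqP ->].
- rewrite -(cardC (val (psi b))) ?(valP (psi b)) //; apply: eq_card => x.
  by rewrite inE clE -{1}(psiK b) (inj_eq phi_inj).
- by apply: same (valP (cl x)) _ _ xy; rewrite // cxy.
rewrite (inj_eq phi_inj) => cxy.
exact: diff (valP (cl x)) (valP (cl y)) _ (mem_cl x) (mem_cl y).
Qed.

Theorem theorem2 (q d : nat) (hq : prime_power q) (hd : 2 <= d)
    (Vs : finType) (e : rel Vs)
    (he : divisible_design_graph e
            ((q ^ d * (q ^ d - 1)) %/ (q - 1))
            (q ^ (d - 1) * (q ^ d - 1))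
            (q ^ (d - 1) * (q ^ d - q ^ (d - 1) - 1))
            (q ^ (d - 2) * (q - 1) * (q ^ d - 1))
            ((q ^ d - 1) %/ (q - 1))
            (q ^ d))
    (P : {set {set Vs}})
    (hP : canonical_partition e
            (q ^ (d - 1) * (q ^ d - q ^ (d - 1) - 1))
            (q ^ (d - 2) * (q - 1) * (q ^ d - 1))
            ((q ^ d - 1) %/ (q - 1))
            (q ^ d) P)
    (Pt Bl : finType) (inc : Pt -> Bl -> bool)
    (hD : symmetric_design inc
            ((q ^ d - 1) %/ (q - 1))
            (q ^ (d - 1))
            (q ^ (d - 2) * (q - 1)))
    (phi : classes P -> Bl) (hphi : bijective phi) :
  strongly_regular_graph (extension_adj e inc phi)
    ((q ^ (2 * d) - 1) %/ (q - 1))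
    (q ^ (2 * d - 1))
    (q ^ (2 * d - 2) * (q - 1))
    (q ^ (2 * d - 2) * (q - 1)).
Proof.
have [beta [adjE fib same diff]] := class_block_map inc hP hphi.
case: he => -[[e_sym e_irr] cardV deg] _ _ _.
have [cardP cardB blk pair] := hD.
have q_gt1 : 1 < q.
  by case: hq => p [r [/prime_gt1 p1 r0 ->]]; rewrite -(exp1n r) ltn_exp2r.
(* In terms of [p], [s] and [m] every parameter becomes polynomial, up to a few predecessors, and
   the only relations left are [q = s.+1] and [p * q ^ 2 = s * m + 1]. *)
pose p := q ^ (d - 2); pose s := q - 1; pose m := (q ^ d - 1) %/ (q - 1).
have p_gt0 : 0 < p by rewrite expn_gt0 ltnW.
have qE : q = s.+1 by rewrite /s; lia.
have s_gt0 : 0 < s by rewrite /s; lia.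
have E1 : q ^ (d - 1) = p * q by rewrite -expnSr; congr expn; lia.
have E2 : q ^ d = p * q ^ 2 by rewrite -expnD; congr expn; lia.
have E3 : q ^ (2 * d - 2) = p ^ 2 * q ^ 2.
  by rewrite -expnM -expnD; congr expn; lia.
have E4 : q ^ (2 * d - 1) = p ^ 2 * q ^ 3.
  by rewrite -expnM -expnD; congr expn; lia.
have E5 : q ^ (2 * d) = (p * q ^ 2) ^ 2.
  by rewrite -E2 -expnM; congr expn; lia.
have mE : p * q ^ 2 - 1 = s * m.
  by rewrite /m /s -E2 mulnC divnK // !subn1 predn_exp dvdn_mulr.
have pq_gt1 : 1 < p * q by rewrite (leq_trans q_gt1) // leq_pmull.
have wE : p * q ^ 2 = s * m + 1.
  by rewrite -mE subnK // muln_gt0 p_gt0 expn_gt0 ltnW.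
have l1E : p * q ^ 2 - p * q - 1 = p * q * s - 1.
  by rewrite expnS expn1 mulnA {2}qE mulnS addKn.
have vE : #|Vs| = p * q ^ 2 * m.
  by rewrite cardV E2 mE mulnCA -/s mulKn.
rewrite E1 E2 mE ?l1E -/s in deg same diff.
rewrite E1 -/p -/s -/m in hD cardP cardB blk pair.
rewrite -/p in diff; rewrite E2 in fib; rewrite -/s E3 E4 E5.
clearbody p s m; clear E1 E2 E3 E4 E5 hP hd cardV.
have params : p * s * m.-1 = p * q * (p * q).-1.
  rewrite -!mulnA; congr muln; rewrite -!subn1 !mulnBr -mE !muln1.
  by rewrite mulnCA mulnn -subnDA add1n -qE.
have rep := symmetric_design_replication hD pq_gt1 params.
have dual := symmetric_design_dual hD pq_gt1 params.
(* Naming the predecessor turns the truncated factor of [l1] into [c]. *)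
have [c cE] : exists c, p * q * s = c.+1.
  by exists (p * q * s).-1; rewrite prednK // !muln_gt0 p_gt0 s_gt0 ltnW.
have equi x b : #|[set y in neighbours e x | beta y == b]| = p * q * s.
  have -> : [set y in neighbours e x | beta y == b]
          = [set y in [set y | beta y == b] | e x y].
    by apply/setP => y; rewrite !inE andbC.
  apply: (@constant_incidence _ _ setT _ (fun x y => e x y) (p * q * (s * m))
            (p * q * (p * q * s - 1))) => [y _|y z|||]; rewrite ?fib ?cardsT ?vE //.
  - by rewrite -(deg y); apply: eq_card => z; rewrite !inE e_sym.
  - rewrite !inE => /eqP yb /eqP zb yz; rewrite -(same y z) ?yb //.
    by apply: eq_card => t; rewrite !inE !(e_sym t).
  - by ring.
  - rewrite -subn1 mE cE subn1 /= -cE.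
    (* As the class size minus one is [s * m], the degree plus [s * m] times [l1] equals the degree
       times [c.+1]. *)
    transitivity (p * q ^ 2 * (p * q * s * m * c.+1)); first by ring.
    by rewrite -cE; ring.
(* The two last parameters coincide, so adjacency of [u] and [w] is irrelevant and one count serves
   both. *)
have common u w : u != w ->
    #|common_neighbours (extension_adj e inc phi) u w| = p ^ 2 * q ^ 2 * s.
  pose G := extension_adj e inc phi.
  have -> : common_neighbours G u w = [set t | G u t && G w t].
    by apply/setP => t; rewrite !inE.
  (* The point [y] lies on [p * q] blocks, and [x] has [p * q * s] neighbours in each corresponding
     class. *)
  have mixed x y : #|[set t | e x t && class_point_adj inc phi t y]| =
      p ^ 2 * q ^ 2 * s.
    transitivity #|[set t in neighbours e x | inc y (beta t)]|.
      by apply: eq_card => t; rewrite !inE adjE.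
    by rewrite (card_fibres _ (equi x)) rep; ring.
  rewrite card_set_sum; case: u w => [x|y] [x'|y'] /= neq.
  - have -> : [set t | e x t && e x' t] = common_neighbours e x x'.
      by apply/setP => t; rewrite !inE.
    under eq_finset => t do rewrite !adjE.
    (* Vertices of different classes share [l2] vertices and the [p * s] points of two blocks;
       vertices of one class share [l1] vertices and a whole block. *)
    have [bxx'|bxx'] := eqVneq (beta x) (beta x'); last first.
      by rewrite diff // dual // -mulnSr -addn1 -wE; ring.
    rewrite same // bxx'; under eq_finset do rewrite andbb.
    by rewrite blk cE subn1 /= -mulnSr -cE; ring.
  - rewrite mixed [X in _ + X]eq_card0 ?addn0 // => t.
    by rewrite inE andbF.
  - rewrite [X in _ + X]eq_card0 => [|t]; last by rewrite inE.
    by rewrite addn0 -(mixed x' y); apply: eq_card => t; rewrite !inE andbC.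
  - rewrite [X in _ + X]eq_card0 => [|t]; last by rewrite inE.
    rewrite addn0.
    under eq_finset => t do rewrite !adjE.
    transitivity #|[set t in setT | inc y (beta t) && inc y' (beta t)]|.
      by apply: eq_card => t; rewrite !inE.
    rewrite (card_fibres (fun b => inc y b && inc y' b) (c := p * q ^ 2)).
      by rewrite pair //; ring.
    by move=> b; rewrite -(fib b); apply: eq_card => t; rewrite !inE.
have irr : irreflexive (extension_adj e inc phi) by case=> /=.
split=> [|u w adj_uw|u w neq_uw _]; last exact: common.
  split.
  - by split=> // -[x|y] [x'|y'] /=.
  (* With [n = p * q ^ 2], the quotient is [(n - 1) * (n + 1) / s = m * (n + 1)]. *)
  - rewrite card_sum vE cardP -[X in _ - X](exp1n 2) subn_sqr mE -(mulnA s) mulKn //.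
    by ring.
  case=> [x|y]; rewrite /neighbours card_set_sum /=.
    rewrite deg; under eq_finset do rewrite adjE.
    by rewrite blk -mulnSr -addn1 -wE; ring.
  rewrite [X in _ + X]eq_card0 => [|z]; last by rewrite inE.
  transitivity #|[set t in setT | inc y (beta t)]|.
    by rewrite addn0; apply: eq_card => t; rewrite !inE adjE.
  rewrite (card_fibres (inc y) (c := p * q ^ 2)) ?rep; first by ring.
  by move=> b; rewrite -(fib b); apply: eq_card => t; rewrite !inE.
by apply: common; apply: contraTneq adj_uw => ->; rewrite irr.
Qed.
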